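(* For an edge-colored directed graph $(G,f)$, $G=(V,E,r,s)$, we have $A(G,f)=\ast_P\,A(G_i)$, where $G_i=(V,f^{-1}(i),r,s)$ for each color $i$ and $P=A((V,\emptyset,r,s))$ is the algebra of the directed graph with vertex set $V$ and no edges.
   Context: A directed graph $G=(V,E,r,s)$ has vertex set $V$, edge set $E$, and range and source maps $r,s:E\to V$. An edge-colored directed graph $(G,f)$ is a directed graph $G$ with a function $f:E\to\mathbb{N}=\{1,2,\dots\}$. A contractive representation $\pi:G\to B(\mathcal{H})$ of a directed graph assigns to the vertices $v$ pairwise orthogonal projections $\pi(v)$ and to the edges $e$ operators $\pi(e)$ with $\pi(e)=\pi(r(e))\pi(e)\pi(s(e))$ such that the row operator $[\pi(e)]_{e\in E}$ is a contraction. A map $\pi:G\to B(\mathcal{H})$ is a contractive representation of $(G,f)$ if its restriction to $(V,f^{-1}(j),r,s)$ is a contractive representation for each $j\in\mathbb{N}$. The same terminology is used for maps into an operator algebra. $A(G,f)$ is the norm closed operator algebra with a contractive representation $\iota:G\to A(G,f)$ of $(G,f)$, whose image generates $A(G,f)$, such that for every contractive representation $\pi:G\to B(\mathcal{H})$ of $(G,f)$ there exists a unique completely contractive representation $\tilde\pi:A(G,f)\to B(\mathcal{H})$ with $\tilde\pi\circ\iota=\pi$. $A(G_i)$ is the corresponding universal algebra of the directed graph $G_i$ (all edges given one color). $P$ is identified with the subalgebra of each $A(G_i)$ generated by the vertex projections. $\ast_P$ denotes the universal free product of operator algebras amalgamated over $P$: the operator algebra generated by copies of the $A(G_i)$ agreeing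 on $P$ such that completely contractive representations of the $A(G_i)$ on a common Hilbert space agreeing on $P$ extend uniquely to a completely contractive representation of the free product. Equality means completely isometric isomorphism identifying the natural generators. *)

(* Defs.v *)
From Corelib Require Import BinNums.
From mathcomp Require Import all_boot all_order all_algebra.
From mathcomp Require Import sesquilinear complex.
From mathcomp Require Import all_classical all_reals all_analysis.

Set Implicit Arguments.
Unset Strict Implicit.
Unset Printing Implicit Defensive.

Import Order.TTheory GRing.Theory Num.Theory.
Import numFieldNormedType.Exports.

Local Open Scope classical_set_scope.
Local Open Scope ring_scope.

Record hilbert (R : realType) := Hilbert {
  hilbert_sort :> completeNormedModType R[i];
  hdot : {dot hilbert_sort for Num.conj};
  hnormE : forall x : hilbert_sort, `|x| ^+ 2 = hdot x x
}.

Section Operators.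
Context {R : realType}.
Implicit Types H K : hilbert R.

(* The norm of the completeNormedModType H takes its values in R[i]. *)
Definition hnorm H (x : H) : R := complex.Re `|x|.

(* The norm of the Hilbert space direct sum of n copies of H. *)
Definition l2norm H n (x : 'I_n -> H) : R :=
  Num.sqrt (\sum_(i < n) hnorm (x i) ^+ 2).

Definition opnorm H (T : H -> H) : \bar R :=
  ereal_sup [set (hnorm (T x))%:E | x in [set x | hnorm x <= 1]].

Definition mxapp H m n (a : 'M[H -> H]_(m, n)) (x : 'I_n -> H) : 'I_m -> H :=
  fun i => \sum_(j < n) a i j (x j).

(* The norm of a matrix of operators, as an operator from H^n to H^m. *)
Definition mxnorm H m n (a : 'M[H -> H]_(m, n)) : \bar R :=
  ereal_sup [set (l2norm (mxapp a x))%:E | x in [set x | l2norm x <= 1]].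

(* B(H), as a set of functions. *)
Definition bounded_op H : set (H -> H) :=
  [set T | linear T /\ (opnorm T < +oo)%E].

(* Self-adjoint idempotents. *)
Definition projection H (p : H -> H) : Prop :=
  [/\ bounded_op p, p \o p = p & forall x y, hdot H (p x) y = hdot H x (p y)].

(* Norm closed subalgebras of B(H); no unit is required. *)
Definition operator_algebra H (A : set (H -> H)) : Prop :=
  [/\ A `<=` @bounded_op H,
      A 0 /\ (forall S T : H -> H, A S -> A T -> A (S + T)),
      forall (c : R[i]) (T : H -> H), A T -> A (c *: T),
      forall S T : H -> H, A S -> A T -> A (S \o T)
    & forall T : H -> H, bounded_op T ->
        (forall e : R, 0 < e -> exists2 S, A S & (opnorm (T - S)%R <= e%:E)%E) ->
        A T].

Definition generated_algebra H (S : set (H -> H)) : set (H -> H) :=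
  smallest (@operator_algebra H) S.

End Operators.

Record opalg (R : realType) := OpAlg {
  space : hilbert R;
  elements : set (space -> space);
  opalgP : operator_algebra elements
}.

Arguments elements {R} o _.

(* The ambient B(K) of an operator algebra A, as a type of functions: maps out
   of A are total functions on [op A] whose values outside [elements A] are
   irrelevant. *)
Notation op A := (space A -> space A).

Section Representations.
Context {R : realType}.
Implicit Types (A B : opalg R) (H : hilbert R).

Definition algebra_hom A H (phi : op A -> (H -> H)) : Prop :=
  [/\ forall S : op A, elements A S -> bounded_op (phi S),
      forall (c : R[i]) (S T : op A), elements A S -> elements A T ->
        phi (c *: S + T) = c *: phi S + phi T
    & forall S T : op A, elements A S -> elements A T ->
        phi (S \o T) = phi S \o phi T].

Definition completely_contractive A H (phi : op A -> (H -> H)) : Prop :=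
  forall n (a : 'M[op A]_n), (forall i j, elements A (a i j)) ->
    (mxnorm (map_mx phi a) <= mxnorm a)%E.

Definition completely_isometric A H (phi : op A -> (H -> H)) : Prop :=
  forall n (a : 'M[op A]_n), (forall i j, elements A (a i j)) ->
    mxnorm (map_mx phi a) = mxnorm a.

Definition cc_rep A H (phi : op A -> (H -> H)) : Prop :=
  algebra_hom phi /\ completely_contractive phi.

Definition ci_embedding A B (phi : op A -> op B) : Prop :=
  [/\ algebra_hom phi, completely_isometric phi
    & phi @` elements A `<=` elements B].

Definition ci_isomorphism A B (phi : op A -> op B) : Prop :=
  ci_embedding phi /\ phi @` elements A = elements B.

End Representations.

Record digraph := Digraph {
  vertex : Type;
  edge : Type;
  rng : edge -> vertex;
  src : edge -> vertex
}.

(* (V, f^-1(i), r, s); the set of colors {1, 2, 3, ...} is the type [positive]. *)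
Definition color_graph (G : digraph) (f : edge G -> positive) (i : positive) :
    digraph :=
  @Digraph (vertex G) {e : edge G | f e = i}
    (fun e => rng (sval e)) (fun e => src (sval e)).

Definition edgeless (G : digraph) : digraph :=
  @Digraph (vertex G) void (of_void _) (of_void _).

Definition one_color (G : digraph) : edge G -> positive := fun=> xH.

Definition color_restrict (G : digraph) (f : edge G -> positive) (X : Type)
    (pi : vertex G + edge G -> X) (i : positive)
    (x : vertex (color_graph f i) + edge (color_graph f i)) : X :=
  match x with inl v => pi (inl v) | inr e => pi (inr (sval e)) end.

Section GraphAlgebras.
Context {R : realType}.
Implicit Types (G : digraph) (H : hilbert R) (A B P F : opalg R).

(* For infinitely many edges, the row operator on the Hilbert space direct sum
   of copies of H indexed by the edges is a contraction iff it is one on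
   finitely supported vectors, i.e. iff all its finite subrows are
   contractions. *)
Definition row_contraction (E : Type) H (T : E -> (H -> H)) : Prop :=
  forall n (e : 'I_n -> E), injective e ->
    (mxnorm (\row_(k < n) T (e k)) <= 1)%E.

Record contractive_rep G H (pi : vertex G + edge G -> (H -> H)) : Prop := {
  rep_proj : forall v, projection (pi (inl v));
  rep_ortho : forall v w, v <> w -> pi (inl v) \o pi (inl w) = 0;
  rep_bounded : forall e, bounded_op (pi (inr e));
  rep_edge : forall e, pi (inr e) =
    pi (inl (rng e)) \o pi (inr e) \o pi (inl (src e));
  rep_row : row_contraction (fun e => pi (inr e))
}.

Definition colored_rep G (f : edge G -> positive) H
    (pi : vertex G + edge G -> (H -> H)) : Prop :=
  forall i, @contractive_rep (color_graph f i) H (color_restrict pi (i := i)).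

(* (A, iota) is A(G, f). *)
Record colored_graph_algebra G (f : edge G -> positive) A
    (iota : vertex G + edge G -> op A) : Prop := {
  cga_rep : colored_rep f iota;
  cga_gen : generated_algebra (range iota) = elements A;
  cga_univ : forall H (pi : vertex G + edge G -> (H -> H)),
    colored_rep f pi ->
    exists phi : op A -> (H -> H),
      [/\ cc_rep phi, phi \o iota = pi
        & forall psi : op A -> (H -> H), cc_rep psi -> psi \o iota = pi ->
            forall S : op A, elements A S -> psi S = phi S]
}.

(* (A, iota) is A(G). *)
Definition graph_algebra G A (iota : vertex G + edge G -> op A) : Prop :=
  colored_graph_algebra (@one_color G) iota.

(* p identifies P, generated by the vertices of the edgeless graph of G, with
   the subalgebra of A generated by the vertex projections. *)
Definition vertex_identification G P
    (iotaP : vertex (edgeless G) + edge (edgeless G) -> op P)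
    A (iota : vertex G + edge G -> op A) (p : op P -> op A) : Prop :=
  [/\ ci_embedding p,
      p @` elements P = generated_algebra (range (iota \o inl))
    & forall v : vertex G, p (iotaP (inl v)) = iota (inl v)].

(* F, with the copies j i of the B i, is the universal free product of the B i
   amalgamated over P along the maps p i from P to B i. *)
Record amalgamated_free_product (I : Type) P (B : I -> opalg R)
    (p : forall i, op P -> op (B i)) F (j : forall i, op (B i) -> op F) :
    Prop := {
  afp_copy : forall i, ci_embedding (j i);
  afp_agree : forall i k S, elements P S -> j i (p i S) = j k (p k S);
  afp_gen :
    generated_algebra (\bigcup_i (j i @` elements (B i))) = elements F;
  afp_univ : forall H (rho : forall i, op (B i) -> (H -> H)),
    (forall i, cc_rep (rho i)) ->
    (forall i k S, elements P S -> rho i (p i S) = rho k (p k S)) ->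
    exists phi : op F -> (H -> H),
      [/\ cc_rep phi,
          forall i S, elements (B i) S -> phi (j i S) = rho i S
        & forall psi : op F -> (H -> H), cc_rep psi ->
            (forall i S, elements (B i) S -> psi (j i S) = rho i S) ->
            forall S, elements F S -> psi S = phi S]
}.

End GraphAlgebras.

(* Main.v *)
Require Import Defs.
From Corelib Require Import BinNums.
From mathcomp Require Import all_boot all_order all_algebra.
From mathcomp Require Import sesquilinear complex.
From mathcomp Require Import all_classical all_reals all_analysis.
From mathcomp Require Import lra.

Set Implicit Arguments.
Unset Strict Implicit.
Unset Printing Implicit Defensive.

Import Order.TTheory GRing.Theory Num.Theory.
Import numFieldNormedType.Exports.

Local Open Scope classical_set_scope.
Local Open Scope ring_scope.

(** Both algebras are determined by their representations, and the two kinds of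
    representations are the same data: a contractive representation of $(G,f)$
    is a family of contractive representations of the graphs $G_i$ that agree
    on the vertices.  So $A(G,f)$ has the universal property of the amalgamated
    free product, and objects with a common universal property are isomorphic.

    Four points need an argument.

    - The copies of $P$ in $A(G_i)$ and of $A(G_i)$ in $A(G,f)$ must be
      completely isometric.  They have completely contractive left inverses,
      because a representation of the smaller graph extends to the larger one
      by sending the additional edges to $0$ ([edgeless_extension_rep],
      [color_extension_rep], [ci_embedding_retract]).

    - A completely contractive representation $\rho$ of $A(G_i)$ must come from
      a contractive representation of $G_i$ ([cc_contractive_rep]).  The rows
      stay contractive since a row is a square matrix after padding by zeros.
      The vertices are sent to contractive idempotents, and on a Hilbert space
      these are self-adjoint ([contractive_idempotent_projection]).

    - Two completely contractive maps that agree on generators agree, since the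
      equalizer is a norm closed algebra ([equalizer_opalg]); in the same way a
      map that sends generators into an operator algebra sends everything there
      ([preimage_opalg]).

    - The image of $P$ in $A(G_i)$ is all of the algebra generated by the
      vertex projections.  The composite of the left inverse with the
      inclusion is the identity on the vertices, hence on the algebra that they
      generate; this replaces the completeness argument for the range of an
      isometry. *)

(** * Linear maps given as functions *)

Section LinearFunctions.
Context {R : realType}.
Variables (U V : lmodType R[i]) (T : U -> V).
Hypothesis linT : linear T.

Lemma lin0 : T 0 = 0.
Proof. by have := linT (-1) 0 0; rewrite scaler0 addr0 scaleN1r addNr. Qed.

Lemma linZ c x : T (c *: x) = c *: T x.
Proof. by have := linT c x 0; rewrite lin0 !addr0. Qed.

Lemma linB x y : T (x - y) = T x - T y.
Proof. by rewrite addrC -scaleN1r linT scaleN1r addrC. Qed.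

End LinearFunctions.

(** * Norms on a Hilbert space *)

Section HilbertNorm.
Context {R : realType}.
Implicit Types H : hilbert R.

Lemma hilbert_normE H (x : H) : `|x| = (hnorm x)%:C%C.
Proof. by rewrite /hnorm RRe_real // ger0_real. Qed.

Lemma hnorm_ge0 H (x : H) : 0 <= hnorm x.
Proof. by rewrite -ler0c -hilbert_normE. Qed.

Lemma hnorm_eq0 H (x : H) : (hnorm x == 0) = (x == 0).
Proof. by rewrite -[RHS]normr_eq0 hilbert_normE -(inj_eq (@complexI R)). Qed.

Lemma hnorm0 H : hnorm (0 : H) = 0.
Proof. by apply/eqP; rewrite hnorm_eq0. Qed.

Lemma hnormZ H (r : R) (x : H) : 0 <= r -> hnorm (r%:C%C *: x) = r * hnorm x.
Proof.
move=> r0; apply: complexI.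
by rewrite -hilbert_normE normrZ hilbert_normE rmorphM /= ger0_norm // ler0c.
Qed.

Lemma ler_hnormD H (x y : H) : hnorm (x + y) <= hnorm x + hnorm y.
Proof. by rewrite -lecR rmorphD /= -!hilbert_normE ler_normD. Qed.

Lemma hnorm_opp H (x : H) : hnorm (- x) = hnorm x.
Proof. by rewrite /hnorm normrN. Qed.

Lemma hnorm_sqr H (x : H) : (hnorm x ^+ 2)%:C%C = hdot H x x.
Proof. by rewrite -hnormE hilbert_normE rmorphXn. Qed.

Lemma l2norm1 H (x : 'I_1 -> H) : l2norm x = hnorm (x ord0).
Proof. by rewrite /l2norm big_ord1 sqrtr_sqr ger0_norm ?hnorm_ge0. Qed.

End HilbertNorm.

(** * Operator and matrix norms *)

Section OperatorNorm.
Context {R : realType}.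
Implicit Types H : hilbert R.

Lemma opnorm_mx H (T : H -> H) :
  mxnorm (const_mx T : 'M[H -> H]_(1, 1)) = opnorm T.
Proof.
have app (x : 'I_1 -> H) :
    l2norm (mxapp (const_mx T : 'M[H -> H]_(1, 1)) x) = hnorm (T (x ord0)).
  by rewrite l2norm1 /mxapp big_ord1 mxE.
congr ereal_sup; apply/seteqP; split => _ [x x1 <-].
  by exists (x ord0); rewrite ?app //= -l2norm1.
by exists (fun=> x); rewrite ?app //= l2norm1.
Qed.

Lemma mxnorm_ext H m m' n (a : 'M[H -> H]_(m, n)) (b : 'M[H -> H]_(m', n)) :
  (forall x, l2norm (mxapp a x) = l2norm (mxapp b x)) -> mxnorm a = mxnorm b.
Proof.
move=> ab; rewrite /mxnorm; congr ereal_sup.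
by apply/seteqP; split=> _ [x x1 <-]; exists x; rewrite ?ab.
Qed.

Lemma mxnorm_row0 H n : (mxnorm (\row_(k < n) (0%R : H -> H)) <= 1)%E.
Proof.
apply: ge_ereal_sup => _ [x _ <-].
rewrite l2norm1 /mxapp big1 ?hnorm0 ?lee_fin // => k _.
by rewrite mxE.
Qed.

Lemma opnorm_leP H (T : H -> H) (M : R) : linear T -> 0 <= M ->
  (opnorm T <= M%:E)%E <-> forall x, hnorm (T x) <= M * hnorm x.
Proof.
move=> linT M0; split => [TM x|TM]; last first.
  apply: ge_ereal_sup => _ [x x1 <-]; rewrite lee_fin (le_trans (TM x)) //.
  by rewrite -[leRHS]mulr1 ler_wpM2l.
have [->|x0] := eqVneq x 0.
  by rewrite (lin0 linT) hnorm0 mulr0.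
have nx : 0 < hnorm x by rewrite lt_neqAle hnorm_ge0 eq_sym hnorm_eq0 x0.
have ix : 0 <= (hnorm x)^-1 by rewrite invr_ge0 hnorm_ge0.
have : ((hnorm (T ((hnorm x)^-1%:C%C *: x)))%:E <= M%:E)%E.
  apply: le_trans TM; apply: ereal_sup_ubound; eexists; last by [].
  by rewrite /= hnormZ // mulVf // gt_eqF.
by rewrite lee_fin (linZ linT) hnormZ // mulrC ler_pdivrMr.
Qed.

Lemma bounded_op0 H : bounded_op (0 : H -> H).
Proof.
have lin_zero : linear (0 : H -> H) by move=> c x y; rewrite scaler0 addr0.
split=> //; apply: le_lt_trans (ltry 0).
by apply/opnorm_leP => // x; rewrite hnorm0 mul0r.
Qed.

Lemma op_eq_approx H (U V : H -> H) : linear U -> linear V ->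
  (forall e : R, 0 < e -> exists W, [/\ linear W,
    (opnorm (U - W)%R <= e%:E)%E & (opnorm (V - W)%R <= e%:E)%E]) ->
  U = V.
Proof.
move=> linU linV UV; apply: funext => x; apply/eqP; rewrite -subr_eq0 -hnorm_eq0.
apply/negPn/negP => d0.
have {}d0 : 0 < hnorm (U x - V x) by rewrite lt_neqAle eq_sym d0 hnorm_ge0.
(* Chosen so that |U x - V x| <= 2 e |x| contradicts |U x - V x| > 0, also
   when x has norm 0. *)
pose e := hnorm (U x - V x) / (3 * (hnorm x + 1)).
have n1 : 0 < 3 * (hnorm x + 1) by have := hnorm_ge0 x; lra.
have e0 : 0 < e by rewrite divr_gt0.
have lin_sub (S T : H -> H) : linear S -> linear T -> linear (S - T).
  move=> linS linT c u v; rewrite -[LHS]/(S (c *: u + v) - T (c *: u + v)).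
  by rewrite linS linT opprD addrACA -scalerBr.
have [W [linW]] := UV _ e0.
move=> /(opnorm_leP (lin_sub _ _ linU linW) (ltW e0))/(_ x) le1.
move=> /(opnorm_leP (lin_sub _ _ linV linW) (ltW e0))/(_ x) le2.
have tri : hnorm (U x - V x) <= e * hnorm x + e * hnorm x.
  rewrite -(subrKA (W x)) (le_trans (ler_hnormD _ _)) // lerD //.
  by rewrite -hnorm_opp opprB.
have de : hnorm (U x - V x) = e * (3 * (hnorm x + 1)) by rewrite /e divfK ?gt_eqF.
have en : 0 <= e * hnorm x by rewrite mulr_ge0 ?hnorm_ge0 // ltW.
by have := tri; rewrite de; lra.
Qed.

End OperatorNorm.

(** * Projections are the contractive idempotents *)

Section Projections.
Context {R : realType}.
Implicit Types H : hilbert R.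

Lemma pythagoras H (x y : H) :
  hdot H x y = 0 -> hnorm (x - y) ^+ 2 = hnorm x ^+ 2 + hnorm y ^+ 2.
Proof.
by move=> xy; apply: complexI; rewrite rmorphD /= !hnorm_sqr; apply: hnormBd.
Qed.

Lemma projection_contractive H (p : H -> H) : projection p -> (opnorm p <= 1)%E.
Proof.
move=> [[linp _] pp sa]; apply/opnorm_leP => // x; rewrite mul1r.
(* p x and (1 - p) x are orthogonal. *)
have px : hdot H (p x) (p x - x) = 0.
  rewrite sa (linB linp) -[p (p x)]/((p \o p) x) pp subrr.
  exact: linear0r.
have := pythagoras px; rewrite subKr => e.
by rewrite -(ler_pXn2r (ltn0Sn 1)) ?nnegrE ?hnorm_ge0 // e lerDl sqr_ge0.
Qed.

(** The range and the kernel of a contractive idempotent are orthogonal: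
    the component [w] of [u] orthogonal to [v] is mapped to [u] by [p], so it
    is at least as long as [u], and there was nothing to subtract. *)
Lemma contractive_idempotent_ortho H (p : H -> H) (u v : H) :
  linear p -> (opnorm p <= 1)%E -> p u = u -> p v = 0 -> hdot H u v = 0.
Proof.
move=> linp /opnorm_leP p1 pu pv.
have [->|v0] := eqVneq v 0; first exact: linear0r.
have n0 : hdot H v v != 0 by rewrite dnorm_eq0.
pose c := - (hdot H u v / hdot H v v).
pose w := u + c *: v.
have wv : hdot H w (c *: v) = 0.
  by rewrite linearZr_LR /= linearDl linearZl_LR /= mulNr divfK // subrr mulr0.
have pw : p w = u by rewrite /w addrC linp pv scaler0 add0r.
have : hnorm u <= hnorm w by rewrite -{1}pw -[leRHS]mul1r; apply: p1.
have e : hnorm u ^+ 2 = hnorm w ^+ 2 + hnorm (c *: v) ^+ 2.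
  by rewrite -(pythagoras wv) addrK.
rewrite -(ler_pXn2r (ltn0Sn 1)) ?nnegrE ?hnorm_ge0 // e gerDl => cv.
have /eqP : hnorm (c *: v) ^+ 2 = 0 by apply: le_anti; rewrite cv sqr_ge0.
rewrite sqrf_eq0 hnorm_eq0 scaler_eq0 (negbTE v0) orbF oppr_eq0 mulf_eq0.
by rewrite invr_eq0 (negbTE n0) orbF => /eqP.
Qed.

(** Splitting [x] and [y] along the range and the kernel of [p], both
    [hdot (p x) y] and [hdot x (p y)] reduce to [hdot (p x) (p y)]. *)
Lemma contractive_idempotent_projection H (p : H -> H) :
  bounded_op p -> (opnorm p <= 1)%E -> p \o p = p -> projection p.
Proof.
move=> bp p1 pp; split=> // x y; have linp := bp.1.
have ppE z : p (p z) = p z by rewrite -[LHS]/((p \o p) z) pp.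
have kerE z : p (z - p z) = 0 by rewrite (linB linp) ppE subrr.
have ran_ker z t : hdot H (p z) (t - p t) = 0.
  exact: (contractive_idempotent_ortho linp).
have ker_ran z t : hdot H (t - p t) (p z) = 0.
  by apply/eqP; rewrite (herm_eq0C (hdot H)); apply/eqP/ran_ker.
transitivity (hdot H (p x) (p y)); apply/eqP; rewrite -subr_eq0.
  by rewrite -(linearBr (hdot H)); apply/eqP/ran_ker.
by rewrite -oppr_eq0 opprB -(linearBl (hdot H)); apply/eqP/ker_ran.
Qed.

End Projections.

(** * Operator algebras and completely contractive maps *)

Section OperatorAlgebras.
Context {R : realType}.
Implicit Types (A B : opalg R) (H : hilbert R).

Lemma opalg_bounded A S : elements A S -> bounded_op S.
Proof. by have [sub _ _ _ _] := opalgP A => /sub. Qed.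

Lemma opalg0 A : elements A 0.
Proof. by have [_ []] := opalgP A. Qed.

Lemma opalgD A S T : elements A S -> elements A T -> elements A (S + T).
Proof. by have [_ [_ AD] _ _ _] := opalgP A; apply: AD. Qed.

Lemma opalgZ A c S : elements A S -> elements A (c *: S).
Proof. by have [_ _ AZ _ _] := opalgP A; apply: AZ. Qed.

Lemma opalgM A S T : elements A S -> elements A T -> elements A (S \o T).
Proof. by have [_ _ _ AM _] := opalgP A; apply: AM. Qed.

Lemma opalgB A S T : elements A S -> elements A T -> elements A (S - T).
Proof. by move=> AS AT; rewrite -scaleN1r; apply/opalgD/opalgZ. Qed.

Lemma opalg_closed A T : bounded_op T ->
  (forall e : R, 0 < e ->
    exists2 S, elements A S & (opnorm (T - S)%R <= e%:E)%E) ->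
  elements A T.
Proof. by have [_ _ _ _ Acl] := opalgP A; apply: Acl. Qed.

Lemma generated_min H (X D : set (H -> H)) :
  operator_algebra D -> X `<=` D -> generated_algebra X `<=` D.
Proof. by move=> algD XD S; apply; split. Qed.

Lemma generated_sub H (X : set (H -> H)) : X `<=` generated_algebra X.
Proof. by move=> S XS D [_]; apply. Qed.

(** The assumption that [X] lies in some operator algebra is what makes the
    intersection defining [generated_algebra X] consist of bounded operators. *)
Lemma generated_opalg A (X : set (op A)) :
  X `<=` elements A -> operator_algebra (generated_algebra X).
Proof.
move=> XA; split.
- by move=> S /(_ _ (conj (opalgP A) XA)); apply: opalg_bounded.
- split=> [|S T gS gT] D DX; first by have [[_ [D0 _] _ _ _] _] := DX.
  by have [[_ [_ DD] _ _ _] _] := DX; exact: DD (gS D DX) (gT D DX).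
- by move=> c T gT D DX; have [[_ _ DZ _ _] _] := DX; exact: DZ (gT D DX).
- by move=> S T gS gT D DX; have [[_ _ _ DM _] _] := DX;
    exact: DM (gS D DX) (gT D DX).
- move=> T bT Tlim D DX; have [[_ _ _ _ Dcl] _] := DX.
  by apply: Dcl => // e /Tlim[S gS TS]; exists S => //; apply: gS.
Qed.

Section Homomorphisms.
Variables (A : opalg R) (H : hilbert R) (phi : op A -> (H -> H)).
Hypothesis hom : algebra_hom phi.

Lemma hom_bounded S : elements A S -> bounded_op (phi S).
Proof. by case: hom => b _ _; apply: b. Qed.

Lemma homD S T : elements A S -> elements A T -> phi (S + T) = phi S + phi T.
Proof. by case: hom => _ l _ AS AT; have := l 1 _ _ AS AT; rewrite !scale1r. Qed.

Lemma hom0 : phi 0 = 0.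
Proof.
by have /eqP := homD (opalg0 A) (opalg0 A); rewrite addr0 -subr_eq subrr => /eqP.
Qed.

Lemma homZ c S : elements A S -> phi (c *: S) = c *: phi S.
Proof.
by case: hom => _ l _ AS; have := l c _ _ AS (opalg0 A); rewrite hom0 !addr0.
Qed.

Lemma homB S T : elements A S -> elements A T -> phi (S - T) = phi S - phi T.
Proof.
move=> AS AT; rewrite -scaleN1r homD //; last exact: opalgZ.
by rewrite homZ // scaleN1r.
Qed.

Lemma homM S T : elements A S -> elements A T -> phi (S \o T) = phi S \o phi T.
Proof. by case: hom => _ _; apply. Qed.

End Homomorphisms.

Lemma cc_opnorm A H (phi : op A -> (H -> H)) S :
  completely_contractive phi -> elements A S -> (opnorm (phi S) <= opnorm S)%E.
Proof.
move=> cc AS; rewrite -!opnorm_mx -map_const_mx.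
by apply: cc => i j; rewrite mxE.
Qed.

(** Contractivity of [phi] makes the preimage of a closed set closed. *)
Lemma preimage_opalg A H (phi : op A -> (H -> H)) (D : set (H -> H)) :
  cc_rep phi -> operator_algebra D ->
  operator_algebra (elements A `&` phi @^-1` D).
Proof.
move=> [hom cc] [_ [D0 DD] DZ DM Dcl].
split=> [S [AS _]|||S T [AS DS] [AT DT]|T bT Tlim].
- exact: opalg_bounded AS.
- split=> [|S T [AS DS] [AT DT]]; split=> /=.
  + exact: opalg0.
  + by rewrite hom0.
  + exact: opalgD.
  + by rewrite homD //; apply: DD.
- by move=> c T [AT DT]; split=> /=; [exact: opalgZ|rewrite homZ //; apply: DZ].
- by split=> /=; [exact: opalgM|rewrite homM //; apply: DM].
have AT : elements A T.
  by apply: opalg_closed => // e /Tlim[S [AS _] TS]; exists S.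
split=> //=; apply: Dcl => [|e /Tlim[S [AS DS] TS]]; first exact: hom_bounded.
exists (phi S) => //; rewrite -homB //.
by apply: le_trans TS; apply: cc_opnorm => //; apply: opalgB.
Qed.

(** Contractivity makes the equalizer closed: if [T] is close to [S] and
    [phi S = psi S], then [phi T] and [psi T] are both close to [phi S]. *)
Lemma equalizer_opalg A H (phi psi : op A -> (H -> H)) :
  cc_rep phi -> cc_rep psi ->
  operator_algebra (elements A `&` [set S | phi S = psi S]).
Proof.
move=> [hom cc] [hom' cc']; split=> [S [AS _]|||S T [AS eS] [AT eT]|T bT Tlim].
- exact: opalg_bounded AS.
- split=> [|S T [AS eS] [AT eT]]; split=> /=.
  + exact: opalg0.
  + by rewrite !hom0.
  + exact: opalgD.
  + by rewrite !homD // eS eT.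
- by move=> c T [AT eT]; split=> /=; [exact: opalgZ|rewrite !homZ // eT].
- by split=> /=; [exact: opalgM|rewrite (homM hom) // (homM hom') // eS eT].
have AT : elements A T.
  by apply: opalg_closed => // e /Tlim[S [AS _] TS]; exists S.
split=> //=; apply: op_eq_approx => [||e /Tlim[S [AS eS] TS]].
- exact: (hom_bounded hom AT).1.
- exact: (hom_bounded hom' AT).1.
exists (phi S); split; first exact: (hom_bounded hom AS).1.
  by rewrite -homB //; apply: le_trans TS; apply: cc_opnorm => //; apply: opalgB.
by rewrite eS -homB //; apply: le_trans TS; apply: cc_opnorm => //; apply: opalgB.
Qed.

Lemma cc_rep_eq A H (phi psi : op A -> (H -> H)) (X : set (op A)) :
  cc_rep phi -> cc_rep psi -> X `<=` elements A ->
  (forall S, X S -> phi S = psi S) ->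
  forall S, generated_algebra X S -> phi S = psi S.
Proof.
move=> cphi cpsi XA e S gS.
have [] // := generated_min (equalizer_opalg cphi cpsi) _ gS.
by move=> T XT; split; [exact: XA|exact: e].
Qed.

Lemma cc_rep_generated A H (phi : op A -> (H -> H)) (X : set (op A)) D :
  cc_rep phi -> operator_algebra D -> X `<=` elements A ->
  (forall S, X S -> D (phi S)) ->
  forall S, generated_algebra X S -> D (phi S).
Proof.
move=> cphi algD XA e S gS.
have [] // := generated_min (preimage_opalg cphi algD) _ gS.
by move=> T XT; split; [exact: XA|exact: e].
Qed.

Lemma cc_rep_id A : cc_rep (id : op A -> op A).
Proof.
split; first by split=> // S; apply: opalg_bounded.
by move=> n a _; rewrite map_mx_id.
Qed.

Lemma cc_rep_comp A B H (phi : op A -> op B) (psi : op B -> (H -> H)) :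
  cc_rep phi -> (forall S, elements A S -> elements B (phi S)) ->
  cc_rep psi -> cc_rep (psi \o phi).
Proof.
move=> [hom cc] AB [hom' cc']; split; first split=> /=.
- by move=> S AS; apply: (hom_bounded hom'); apply: AB.
- move=> c S T AS AT; have [_ l _] := hom; have [_ l' _] := hom'.
  by rewrite l // l' //; apply: AB.
- by move=> S T AS AT; rewrite (homM hom) // (homM hom') //; apply: AB.
move=> n a Aa; rewrite map_mx_comp (le_trans _ (cc _ _ Aa)) //.
by apply: cc' => i j; rewrite mxE; apply: AB.
Qed.

Lemma ci_embedding_cc A B (phi : op A -> op B) : ci_embedding phi -> cc_rep phi.
Proof. by move=> [hom ci _]; split=> // n a /ci ->. Qed.

Lemma ci_embedding_elements A B (phi : op A -> op B) S :
  ci_embedding phi -> elements A S -> elements B (phi S).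
Proof. by move=> [_ _ sub] AS; apply: sub; exists S. Qed.

(** The norm of a matrix can only decrease under [phi] and under [psi], and
    applying both gives the matrix back. *)
Lemma ci_embedding_retract A B (phi : op A -> op B) (psi : op B -> op A) :
  cc_rep phi -> (forall S, elements A S -> elements B (phi S)) ->
  cc_rep psi -> (forall S, elements A S -> psi (phi S) = S) ->
  ci_embedding phi.
Proof.
move=> [hom cc] AB [_ cc'] K; split=> //; last by move=> _ [S AS <-]; apply: AB.
move=> n a Aa; apply/eqP; rewrite eq_le cc //=.
have {1}-> : a = map_mx psi (map_mx phi a).
  by apply/matrixP => i j; rewrite !mxE K.
by apply: cc' => i j; rewrite mxE; apply: AB.
Qed.

(** Complete contractivity speaks of square matrices, whereas contractive
    representations are about rows.  Padding a row by zero rows makes it square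
    without changing its norm, and a homomorphism preserves the padding. *)
Definition row_square H n (T : 'I_n -> (H -> H)) : 'M[H -> H]_n :=
  \matrix_(i, j) if val i == 0%N then T j else 0.

Lemma mxnorm_row_square H n (T : 'I_n -> (H -> H)) :
  mxnorm (row_square T) = mxnorm (\row_k T k).
Proof.
apply: mxnorm_ext => x; rewrite l2norm1 /l2norm /mxapp.
(* The square matrix of size 0 has no first row; both norms are 0. *)
case: n T x => [|n] T x; first by rewrite !big_ord0 sqrtr0 hnorm0.
rewrite big_ord_recl /= [X in _ + X]big1 => [|i _].
  rewrite addr0 sqrtr_sqr ger0_norm ?hnorm_ge0 //; congr hnorm.
  by apply: eq_bigr => j _; rewrite !mxE.
rewrite big1 ?hnorm0 ?expr0n // => j _.
by rewrite mxE.
Qed.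

Lemma cc_row A H (phi : op A -> (H -> H)) n (T : 'I_n -> op A) :
  cc_rep phi -> (forall k, elements A (T k)) ->
  (mxnorm (\row_k phi (T k)) <= mxnorm (\row_k T k))%E.
Proof.
move=> [hom cc] AT; rewrite -!mxnorm_row_square.
have -> : row_square (phi \o T) = map_mx phi (row_square T).
  by apply/matrixP => i j; rewrite !mxE; case: ifP => //; rewrite hom0.
by apply: cc => i j; rewrite mxE; case: ifP => // _; apply: opalg0.
Qed.

End OperatorAlgebras.

(** * Contractive representations of graphs *)

Section GraphRepresentations.
Context {R : realType}.
Implicit Types (G : digraph) (H : hilbert R) (A B : opalg R).

Lemma contractive_rep_color G (f : edge G -> positive) H
    (pi : vertex G + edge G -> (H -> H)) i :
  contractive_rep pi ->
  @contractive_rep R (color_graph f i) H (color_restrict pi (i := i)).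
Proof.
move=> [proj ortho bd edg row]; split=> //=.
move=> n e inje; apply: (row n (fun k => sval (e k))) => k l ekl.
by apply: inje; apply: eq_sig_hprop => // x; apply: Prop_irrelevance.
Qed.

Lemma one_color_repP G H (pi : vertex G + edge G -> (H -> H)) :
  colored_rep (@one_color G) pi <-> contractive_rep pi.
Proof.
split=> [/(_ xH)[proj ortho bd edg row]|cpi i]; last exact: contractive_rep_color.
pose mono (e : edge G) : edge (color_graph (@one_color G) xH) :=
  exist _ e erefl.
split=> // [e|e|n e inje]; [exact: (bd (mono e))|exact: (edg (mono e))|].
by apply: (row n (mono \o e)) => k l /(congr1 sval)/inje.
Qed.

Definition edgeless_extension G H (q : vertex G -> (H -> H))
    (x : vertex G + edge G) : H -> H :=
  if x is inl v then q v else 0.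

Lemma edgeless_extension_rep G H (q : vertex G -> (H -> H)) :
  (forall v, projection (q v)) -> (forall v w, v <> w -> q v \o q w = 0) ->
  contractive_rep (edgeless_extension q).
Proof.
move=> proj ortho; split=> //=.
- by move=> e; apply: bounded_op0.
- move=> e; apply: funext => x /=.
  by have [[lin _] _ _] := proj (rng e); rewrite (lin0 lin).
by move=> n e _; apply: mxnorm_row0.
Qed.

Definition color_extension G (f : edge G -> positive) i H
    (pi : vertex (color_graph f i) + edge (color_graph f i) -> (H -> H))
    (x : vertex G + edge G) : H -> H :=
  match x with
  | inl v => pi (inl v)
  | inr e => if pselect (f e = i) is left fe then pi (inr (exist _ e fe)) else 0
  end.

Lemma color_extensionK G (f : edge G -> positive) i H
    (pi : vertex (color_graph f i) + edge (color_graph f i) -> (H -> H)) :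
  color_restrict (color_extension pi) (i := i) = pi.
Proof.
apply: funext => -[//|[e fe]] /=; case: pselect => // fe'.
by congr (pi (inr _)); apply: eq_exist.
Qed.

(** In every color but [i] all edges are sent to [0], so only the vertices
    matter. *)
Lemma color_extension_rep G (f : edge G -> positive) i H
    (pi : vertex (color_graph f i) + edge (color_graph f i) -> (H -> H)) :
  contractive_rep pi -> colored_rep f (color_extension pi).
Proof.
move=> cpi k; have [<-|ik] := pselect (i = k); first by rewrite color_extensionK.
have -> : color_restrict (color_extension pi) (i := k) =
    @edgeless_extension (color_graph f k) H (pi \o inl).
  apply: funext => -[//|[e fe]] /=; case: pselect => // fe'.
  by case: ik; rewrite -fe' fe.
by apply: edgeless_extension_rep; [exact: rep_proj cpi|exact: rep_ortho cpi].
Qed.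

(** Homomorphisms need not respect adjoints; that the image of a vertex is
    again a self-adjoint idempotent is due to its norm being at most 1. *)
Lemma cc_contractive_rep A H (phi : op A -> (H -> H)) G
    (pi : vertex G + edge G -> op A) :
  cc_rep phi -> (forall x, elements A (pi x)) ->
  contractive_rep pi -> contractive_rep (phi \o pi).
Proof.
move=> cphi Api [proj ortho bd edg row]; have [hom cc] := cphi.
split=> /= [v|v w vw|e|e|n e inje].
- apply: contractive_idempotent_projection.
  + exact: hom_bounded.
  + by apply: le_trans (projection_contractive (proj v)); apply: cc_opnorm.
  + by rewrite -(homM hom) //; congr phi; have [] := proj v.
- by rewrite -(homM hom) // ortho // hom0.
- exact: hom_bounded.
- rewrite -(homM hom) // -(homM hom) //; last exact: opalgM.
  by congr phi; apply: edg.
- exact: le_trans (cc_row cphi _) (row n e inje).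
Qed.

End GraphRepresentations.

(** * Universal algebras of edge-colored graphs *)

Section ColoredGraphAlgebras.
Context {R : realType}.
Variables (G : digraph) (f : edge G -> positive) (A : opalg R).
Variable iota : vertex G + edge G -> op A.
Hypothesis hA : colored_graph_algebra f iota.

Lemma cga_elements x : elements A (iota x).
Proof. by rewrite -(cga_gen hA); apply: generated_sub; exists x. Qed.

Lemma range_cga : range iota `<=` elements A.
Proof. by move=> _ [x _ <-]; apply: cga_elements. Qed.

Lemma cga_lift (H : hilbert R) (pi : vertex G + edge G -> (H -> H)) :
  colored_rep f pi ->
  exists phi : op A -> (H -> H), cc_rep phi /\ forall x, phi (iota x) = pi x.
Proof.
by move=> /(cga_univ hA)[phi [cphi <- _]]; exists phi.
Qed.

Lemma cga_ext (H : hilbert R) (phi psi : op A -> (H -> H)) :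
  cc_rep phi -> cc_rep psi -> (forall x, phi (iota x) = psi (iota x)) ->
  forall S, elements A S -> phi S = psi S.
Proof.
move=> cphi cpsi e; rewrite -(cga_gen hA); apply: cc_rep_eq => //.
  exact: range_cga.
by move=> _ [x _ <-].
Qed.

Lemma cga_into (B : opalg R) (phi : op A -> op B) :
  cc_rep phi -> (forall x, elements B (phi (iota x))) ->
  forall S, elements A S -> elements B (phi S).
Proof.
move=> cphi e; rewrite -(cga_gen hA); apply: cc_rep_generated => //.
- exact: opalgP.
- exact: range_cga.
- by move=> _ [x _ <-].
Qed.

End ColoredGraphAlgebras.

(** * Subgraphs give completely isometric copies *)

Section Copies.
Context {R : realType}.

(** The inclusion [p] extends the vertices of [iota]; its left inverse [q]
    comes from the representation of the graph that is [iotaP] on vertices and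
    [0] on edges. *)
Lemma vertex_identification_exists (G : digraph) (B P : opalg R)
    (iota : vertex G + edge G -> op B)
    (iotaP : vertex (edgeless G) + edge (edgeless G) -> op P) :
  graph_algebra iota -> graph_algebra iotaP ->
  exists p : op P -> op B, vertex_identification iotaP iota p.
Proof.
move=> hB hP.
have repB := (one_color_repP _).1 (cga_rep hB).
have repP := (one_color_repP _).1 (cga_rep hP).
have [p [ccp pE]] : exists p : op P -> op B, cc_rep p /\
    forall x, p (iotaP x) = @edgeless_extension _ (edgeless G) _ (iota \o inl) x.
  apply: (cga_lift hP); apply/one_color_repP.
  by apply: edgeless_extension_rep; [exact: rep_proj repB|exact: rep_ortho repB].
have [q [ccq qE]] : exists q : op B -> op P, cc_rep q /\
    forall x, q (iota x) = @edgeless_extension _ G _ (fun v => iotaP (inl v)) x.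
  apply: (cga_lift hB); apply/one_color_repP.
  by apply: edgeless_extension_rep; [exact: rep_proj repP|exact: rep_ortho repP].
have PB : forall S, elements P S -> elements B (p S).
  by apply: (cga_into hP ccp) => -[v|[]]; rewrite pE; apply: (cga_elements hB).
have BP : forall S, elements B S -> elements P (q S).
  apply: (cga_into hB ccq) => -[v|e]; rewrite qE; last exact: opalg0.
  exact: (cga_elements hP).
have pK : forall S, elements P S -> q (p S) = S.
  apply: (cga_ext hP (cc_rep_comp ccp PB ccq) (cc_rep_id P)) => -[v|[]] /=.
  by rewrite pE /= qE.
have vertB : range (iota \o inl) `<=` elements B.
  by move=> _ [v _ <-]; apply: (cga_elements hB).
have qK : forall S, generated_algebra (range (iota \o inl)) S -> p (q S) = S.
  apply: (cc_rep_eq (cc_rep_comp ccq BP ccp) (cc_rep_id B) vertB).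
  by move=> _ [v _ <-] /=; rewrite qE /= pE.
exists p; split; first exact: ci_embedding_retract pK.
  apply/seteqP; split=> [_ [S PS <-]|T gT].
    move: S PS; rewrite -(cga_gen hP).
    apply: (cc_rep_generated ccp (generated_opalg vertB) (range_cga hP)).
    by move=> _ [[v|[]] _ <-]; rewrite pE; apply: generated_sub; exists v.
  exists (q T); last exact: qK.
  by apply/BP/(generated_min (opalgP B) vertB).
by move=> v; rewrite pE.
Qed.

(** The left inverse of [j] comes from the representation of the colored graph
    that sends the edges of the other colors to [0]. *)
Lemma color_copy (G : digraph) (f : edge G -> positive) (A : opalg R)
    (iota : vertex G + edge G -> op A) i (B : opalg R)
    (iotaB : vertex (color_graph f i) + edge (color_graph f i) -> op B) :
  colored_graph_algebra f iota -> graph_algebra iotaB ->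
  exists j : op B -> op A,
    ci_embedding j /\ forall x, j (iotaB x) = color_restrict iota x.
Proof.
move=> hA hB.
have [j [ccj jE]] : exists j : op B -> op A, cc_rep j /\
    forall x, j (iotaB x) = color_restrict iota x.
  by apply: (cga_lift hB); apply/one_color_repP/(cga_rep hA).
have [q [ccq qE]] : exists q : op A -> op B, cc_rep q /\
    forall x, q (iota x) = color_extension iotaB x.
  by apply: (cga_lift hA); apply/color_extension_rep/one_color_repP/(cga_rep hB).
have BA : forall S, elements B S -> elements A (j S).
  by apply: (cga_into hB ccj) => -[v|e]; rewrite jE; apply: (cga_elements hA).
exists j; split=> //; apply: ci_embedding_retract (ccq) _ => //.
apply: (cga_ext hB (cc_rep_comp ccj BA ccq) (cc_rep_id B)) => x /=.
rewrite jE -[RHS](congr1 (fun h => h x) (color_extensionK iotaB)).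
by case: x => [v|e] /=; rewrite qE.
Qed.

End Copies.

(** * Amalgamated free products *)

Section FreeProduct.
Context {R : realType}.

Lemma afp_ext I P (B : I -> opalg R) (p : forall i, op P -> op (B i)) F
    (j : forall i, op (B i) -> op F) (H : hilbert R)
    (phi psi : op F -> (H -> H)) :
  amalgamated_free_product p j -> cc_rep phi -> cc_rep psi ->
  (forall i S, elements (B i) S -> phi (j i S) = psi (j i S)) ->
  forall S, elements F S -> phi S = psi S.
Proof.
move=> hF cphi cpsi e; rewrite -(afp_gen hF); apply: cc_rep_eq => //.
  move=> _ [i _ [S BS <-]]; exact: ci_embedding_elements (afp_copy hF i) BS.
by move=> _ [i _ [S BS <-]]; apply: e.
Qed.

Lemma afp_into I P (B : I -> opalg R) (p : forall i, op P -> op (B i)) F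
    (j : forall i, op (B i) -> op F) (F' : opalg R) (phi : op F -> op F') :
  amalgamated_free_product p j -> cc_rep phi ->
  (forall i S, elements (B i) S -> elements F' (phi (j i S))) ->
  forall S, elements F S -> elements F' (phi S).
Proof.
move=> hF cphi e; rewrite -(afp_gen hF); apply: cc_rep_generated => //.
- exact: opalgP.
- move=> _ [i _ [S BS <-]]; exact: ci_embedding_elements (afp_copy hF i) BS.
- by move=> _ [i _ [S BS <-]]; apply: e.
Qed.

Lemma afp_comparison I P (B : I -> opalg R) (p : forall i, op P -> op (B i))
    F (j : forall i, op (B i) -> op F) F' (j' : forall i, op (B i) -> op F') :
  amalgamated_free_product p j -> amalgamated_free_product p j' ->
  exists phi : op F -> op F',
    [/\ cc_rep phi, forall S, elements F S -> elements F' (phi S)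
      & forall i S, elements (B i) S -> phi (j i S) = j' i S].
Proof.
move=> hF hF'.
have [phi [cphi phiE _]] := afp_univ hF
  (fun i => ci_embedding_cc (afp_copy hF' i)) (afp_agree hF').
exists phi; split=> //; apply: (afp_into hF cphi) => i S BS.
by rewrite phiE //; apply: ci_embedding_elements (afp_copy hF' i) BS.
Qed.

Lemma afp_unique I P (B : I -> opalg R) (p : forall i, op P -> op (B i))
    F (j : forall i, op (B i) -> op F) F' (j' : forall i, op (B i) -> op F') :
  amalgamated_free_product p j -> amalgamated_free_product p j' ->
  exists phi : op F -> op F', ci_isomorphism phi /\
    forall i S, elements (B i) S -> phi (j i S) = j' i S.
Proof.
move=> hF hF'.
have [phi [cphi phiF phiE]] := afp_comparison hF hF'.
have [psi [cpsi psiF psiE]] := afp_comparison hF' hF.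
have phiK : forall S, elements F S -> psi (phi S) = S.
  apply: (afp_ext hF (cc_rep_comp cphi phiF cpsi) (cc_rep_id F)) => i S BS /=.
  by rewrite phiE // psiE.
have psiK : forall S, elements F' S -> phi (psi S) = S.
  apply: (afp_ext hF' (cc_rep_comp cpsi psiF cphi) (cc_rep_id F')) => i S BS /=.
  by rewrite psiE // phiE.
exists phi; split=> //; split; first exact: ci_embedding_retract phiK.
apply/seteqP; split=> [_ [S FS <-]|T FT]; first exact: phiF.
by exists (psi T); [exact: psiF|exact: psiK].
Qed.

(** A compatible family [rho] restricts to the generators of the graphs of the
    single colors, and these restrictions fit together to a representation
    [pi] of the colored graph, as they agree on the vertices through [P]. *)
Lemma colored_graph_algebra_afp (G : digraph) (f : edge G -> positive)
    (A : opalg R) (iota : vertex G + edge G -> op A) (B : positive -> opalg R)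
    (iotaB : forall i : positive,
       vertex (color_graph f i) + edge (color_graph f i) -> op (B i))
    (P : opalg R) (iotaP : vertex (edgeless G) + edge (edgeless G) -> op P)
    (p : forall i, op P -> op (B i)) (j : forall i, op (B i) -> op A) :
  colored_graph_algebra f iota -> (forall i, graph_algebra (iotaB i)) ->
  graph_algebra iotaP ->
  (forall i, @vertex_identification R (color_graph f i) P iotaP
     (B i) (iotaB i) (p i)) ->
  (forall i, ci_embedding (j i)) ->
  (forall i x, j i (iotaB i x) = color_restrict iota x) ->
  amalgamated_free_product p j.
Proof.
move=> hA hB hP hp cij jE.
have ccp i : cc_rep (p i) by have [cip _ _] := hp i; apply: ci_embedding_cc.
have pB i S : elements P S -> elements (B i) (p i S).
  by have [cip _ _] := hp i; apply: ci_embedding_elements.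
have pE i v : p i (iotaP (inl v)) = iotaB i (inl v) by have [_ _] := hp i; apply.
have jA i S : elements (B i) S -> elements A (j i S).
  exact: ci_embedding_elements.
have ccj i : cc_rep (j i) by apply: ci_embedding_cc.
split=> //.
- move=> i k; apply: (cga_ext hP (cc_rep_comp (ccp i) (@pB i) (ccj i))
    (cc_rep_comp (ccp k) (@pB k) (ccj k))) => -[v|[]] /=.
  by rewrite !pE !jE.
- have copiesA : \bigcup_i (j i @` elements (B i)) `<=` elements A.
    by move=> _ [i _ [S BS <-]]; apply: jA.
  apply/seteqP; split; first exact: generated_min (opalgP A) copiesA.
  rewrite -(cga_gen hA); apply: generated_min (generated_opalg copiesA) _.
  move=> _ [x _ <-]; apply: generated_sub; case: x => [v|e].
    exists xH => //; exists (iotaB xH (inl v)); last exact: jE.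
    exact: (cga_elements (hB xH)).
  exists (f e) => //; exists (iotaB (f e) (inr (exist _ e erefl))).
    exact: (cga_elements (hB (f e))).
  exact: jE.
move=> H rho ccrho rhoP.
(* By compatibility any color may be used for the vertices; 1 is one. *)
pose pi (x : vertex G + edge G) : H -> H := match x with
  | inl v => rho xH (iotaB xH (inl v))
  | inr e => rho (f e) (iotaB (f e) (inr (exist _ e erefl)))
  end.
have piE i x : color_restrict pi x = rho i (iotaB i x).
  case: x => [v|[e fe]] /=; last by case: i / fe.
  by rewrite -!pE; apply: rhoP; apply: (cga_elements hP).
have reppi : colored_rep f pi.
  move=> i; rewrite (_ : color_restrict pi (i := i) = rho i \o iotaB i); last first.
    by apply: funext => x; apply: piE.
  apply: cc_contractive_rep => //; first exact: (cga_elements (hB i)).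
  exact/one_color_repP/(cga_rep (hB i)).
have [phi [ccphi phiE]] := cga_lift hA reppi.
have phij i : forall S, elements (B i) S -> phi (j i S) = rho i S.
  apply: (cga_ext (hB i) (cc_rep_comp (ccj i) (@jA i) ccphi) (ccrho i)) => x /=.
  by rewrite jE -piE; case: x => [v|e] /=; rewrite phiE.
exists phi; split=> // psi ccpsi psij.
apply: (cga_ext hA ccpsi ccphi) => -[v|e].
  have gB := cga_elements (hB xH) (inl v).
  by have := psij xH _ gB; rewrite -(phij xH _ gB) !jE.
have gB := cga_elements (hB (f e)) (inr (exist _ e erefl)).
by have := psij (f e) _ gB; rewrite -(phij (f e) _ gB) !jE.
Qed.

End FreeProduct.

(** * The isomorphism *)

Theorem corollary2 (R : realType) (G : digraph) (f : edge G -> positive)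
  (A : opalg R) (iota : vertex G + edge G -> op A)
  (hA : colored_graph_algebra f iota)
  (B : positive -> opalg R)
  (iotaB : forall i : positive,
     vertex (color_graph f i) + edge (color_graph f i) -> op (B i))
  (hB : forall i : positive, graph_algebra (iotaB i))
  (P : opalg R)
  (iotaP : vertex (edgeless G) + edge (edgeless G) -> op P)
  (hP : graph_algebra iotaP) :
  exists p : forall i : positive, op P -> op (B i),
    [/\ forall i : positive,
          @vertex_identification R (color_graph f i) P iotaP
            (B i) (iotaB i) (p i),
        exists j : forall i : positive, op (B i) -> op A,
          amalgamated_free_product p j /\
          forall (i : positive)
                 (x : vertex (color_graph f i) + edge (color_graph f i)),
            j i (iotaB i x) = color_restrict iota x
      & forall (F : opalg R) (j : forall i : positive, op (B i) -> op F),
          amalgamated_free_product p j ->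
          exists Phi : op A -> op F,
            ci_isomorphism Phi /\
            forall (i : positive)
                   (x : vertex (color_graph f i) + edge (color_graph f i)),
              Phi (color_restrict iota x) = j i (iotaB i x)].
Proof.
pose p i := sval (cid (vertex_identification_exists (hB i) hP)).
have pP i := svalP (cid (vertex_identification_exists (hB i) hP)).
pose j i := sval (cid (color_copy hA (hB i))).
have jP i := svalP (cid (color_copy hA (hB i))).
have afpA : amalgamated_free_product p j.
  apply: (colored_graph_algebra_afp hA hB hP pP).
    by move=> i; have [] := jP i.
  by move=> i; have [] := jP i.
exists p; split; first exact: pP.
  by exists j; split=> // i; have [] := jP i.
move=> F jF afpF; have [Phi [isoPhi PhiE]] := afp_unique afpA afpF.
exists Phi; split=> // i x; have [_ <-] := jP i.
exact/PhiE/(cga_elements (hB i)).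
Qed.
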